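(* Let $X$ be a set and let $\prec$ be a neighbourhood operator on $X$ satisfying axioms (N0), (N1), (N2), (N3). Then the following are equivalent: (1) $\prec$ satisfies (N4): for all subsets $A \prec C$ of $X$ there is a subset $B\subseteq X$ with $A \prec B \prec C$; (2) for any subsets $A$ and $B$ of $X$ such that $A \prec X \setminus B$, there is a neighbourhood continuous function $f: X \rightarrow [0,1]$ such that $f(A) \subseteq \{0\}$ and $f(B) \subseteq \{1\}$.
   Context: A neighbourhood operator on a set $X$ is a binary relation $\prec$ on the power set of $X$ such that $A \prec B$ implies $A \subseteq B$. Axioms: (N0) $A \prec X$ for all $A \subseteq X$. (N1) If $A \prec B$ then $X \setminus B \prec X \setminus A$. (N2) If $A \prec B \subseteq C$, then $A \prec C$. (N3) If $A \prec N$ and $A' \prec N'$ then $A \cup A' \prec N \cup N'$. If $X,Y$ are sets with neighbourhood operators $\prec_X,\prec_Y$, a map $f:X\to Y$ is neighbourhood continuous if $A \prec_Y B$ implies $f^{-1}(A) \prec_X f^{-1}(B)$ for all $A,B\subseteq Y$. The topological neighbourhood operator on a topological space is defined by: $A \prec B$ if and only if $B$ contains an open set containing the closure $\mathrm{cl}(A)$. A map from $(X,\prec)$ to a subset of $\mathbb{R}$ is called neighbourhood continuous if it is so with respect to $\prec$ on $X$ and the topological neighbourhood operator on the codomain. *)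

(* Defs.v *)
From HB Require Import structures.
From mathcomp Require Import all_boot all_order all_algebra.
From mathcomp Require Import all_classical all_reals topology normedtype.

Set Implicit Arguments.
Unset Strict Implicit.
Unset Printing Implicit Defensive.

Import Order.TTheory GRing.Theory Num.Theory.
Import numFieldNormedType.Exports.

Local Open Scope classical_set_scope.

Definition neighbourhood_operator (X : Type) (prec : set X -> set X -> Prop) :=
  forall A B : set X, prec A B -> A `<=` B.

Definition N0 (X : Type) (prec : set X -> set X -> Prop) :=
  forall A : set X, prec A [set: X].

Definition N1 (X : Type) (prec : set X -> set X -> Prop) :=
  forall A B : set X, prec A B -> prec (~` B) (~` A).

Definition N2 (X : Type) (prec : set X -> set X -> Prop) :=
  forall A B C : set X, prec A B -> B `<=` C -> prec A C.

Definition N3 (X : Type) (prec : set X -> set X -> Prop) :=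
  forall A N A' N' : set X,
    prec A N -> prec A' N' -> prec (A `|` A') (N `|` N').

Definition N4 (X : Type) (prec : set X -> set X -> Prop) :=
  forall A C : set X, prec A C -> exists B : set X, prec A B /\ prec B C.

Definition neighbourhood_continuous (X Y : Type)
    (precX : set X -> set X -> Prop) (precY : set Y -> set Y -> Prop)
    (f : X -> Y) :=
  forall A B : set Y, precY A B -> precX (f @^-1` A) (f @^-1` B).

Definition topological_prec (T : topologicalType) (A B : set T) : Prop :=
  exists U : set T, [/\ open U, closure A `<=` U & U `<=` B].

Lemma topological_prec_operator (T : topologicalType) :
  neighbourhood_operator (@topological_prec T).
Proof.
move=> A B [U [_ clAU UB]].
by apply: subset_trans UB; apply: subset_trans clAU; exact: subset_closure.
Qed.

(* [set_type] carries the initial topology along the inclusion into [R], so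
   open sets and closures are relative to [0, 1]. *)
Definition unit_interval (R : realType) : topologicalType :=
  set_type `[0%R, 1%R : R]%classic.

(* Main.v *)
Require Import Defs.
From HB Require Import structures.
From mathcomp Require Import all_boot all_order all_algebra.
From mathcomp Require Import all_classical all_reals topology normedtype.
From mathcomp Require Import finmap lra.

Set Implicit Arguments.
Unset Strict Implicit.
Unset Printing Implicit Defensive.

Import Order.TTheory GRing.Theory Num.Theory.
Import numFieldNormedType.Exports.

Local Open Scope classical_set_scope.
Local Open Scope ring_scope.

(** As in Urysohn's lemma, iterating (N4) between [A] and [X \ B] gives sets
    [V n k], read as the dyadic level [k / 2^n], each [≺]-below the next, and
    [g x] is the infimum of the levels of the sets containing [x].  Then
    [{g <= a} ≺ {g < b}] whenever [a < b], and by (N1) and (N3) preimages of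
    intervals are [≺]-below those of larger intervals.  Compactness of [0, 1]
    covers a closed subset of an open set [W] by finitely many intervals whose
    enlargements stay in [W], and (N3) glues them together.  Conversely, if [f]
    separates [A] from [X \ C], then [f^-1 [0, 1/2)] interpolates between [A]
    and [C]. *)

(** Shrinking on the left is enlarging on the right after taking complements, so (N1) turns (N2)
    into monotonicity in both arguments. *)
Lemma precW (X : Type) (prec : set X -> set X -> Prop) :
  N1 prec -> N2 prec -> forall A' A B B' : set X,
  A' `<=` A -> B `<=` B' -> prec A B -> prec A' B'.
Proof.
move=> p1 p2 A' A B B' AA BB AB; apply: (p2 _ _ _ _ BB).
by rewrite -[A']setCK -[B]setCK; apply/p1/(p2 _ _ _ (p1 _ _ AB))/subsetC.
Qed.

Lemma prec_set0 (X : Type) (prec : set X -> set X -> Prop) :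
  N0 prec -> N1 prec -> forall A : set X, prec set0 A.
Proof. by move=> p0 p1 A; have := p1 _ _ (p0 (~` A)); rewrite setCT setCK. Qed.

Lemma prec_setI (X : Type) (prec : set X -> set X -> Prop) :
  N1 prec -> N3 prec -> forall A N A' N' : set X,
  prec A N -> prec A' N' -> prec (A `&` A') (N `&` N').
Proof.
move=> p1 p3 A N A' N' AN AN'.
by have := p1 _ _ (p3 _ _ _ _ (p1 _ _ AN) (p1 _ _ AN')); rewrite !setCU !setCK.
Qed.

Lemma prec_bigcup_fset (X : Type) (prec : set X -> set X -> Prop)
    (I : choiceType) (D : {fset I}) (F : I -> set X) (N : set X) :
  N0 prec -> N1 prec -> N3 prec ->
  (forall i, i \in D -> prec (F i) N) -> prec (\bigcup_(i in [set` D]) F i) N.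
Proof.
move=> p0 p1 p3 FN; rewrite bigcup_fset big_seq; elim/big_ind : _ => //.
- exact: prec_set0.
- by move=> A B AN BN; rewrite -(setUid N); exact: p3.
Qed.

Section dyadic_chain.
Variables (X : Type) (prec : set X -> set X -> Prop).
Variables (interp : set X -> set X -> set X) (V0 : nat -> set X).
Hypothesis prec_op : neighbourhood_operator prec.
Hypothesis interpP : forall A C, prec A C ->
  prec A (interp A C) /\ prec (interp A C) C.
Hypothesis V0P : forall k, prec (V0 k) (V0 k.+1).

(** Halving an even index leaves the fraction [k / 2^n] and its set unchanged; odd indices are the
    new midpoints. Indices are unbounded, which avoids any side condition [k <= 2^n]. *)
Fixpoint dyadic_chain (n : nat) : nat -> set X :=
  if n is m.+1 then fun k =>
    if odd k then interp (dyadic_chain m k./2) (dyadic_chain m k./2.+1)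
    else dyadic_chain m k./2
  else V0.

Lemma dyadic_chain_prec n k : prec (dyadic_chain n k) (dyadic_chain n k.+1).
Proof.
elim: n k => [|n IHn] k /=; first exact: V0P.
(* Half of [k.+1] is [k./2] plus the parity of [k]: an even [k] asks for the lower half of an
   interpolation, an odd one for the upper half. *)
rewrite uphalf_half; have [H1 H2] := interpP (IHn k./2).
by case: (odd k).
Qed.

Lemma dyadic_chain_homo n i j :
  (i <= j)%N -> dyadic_chain n i `<=` dyadic_chain n j.
Proof.
move=> ij; rewrite -(subnK ij); elim: (j - i)%N => [//|d IH].
exact: subset_trans IH (prec_op (dyadic_chain_prec _ _)).
Qed.

Lemma dyadic_chainD n m k :
  dyadic_chain (m + n) (k * 2 ^ m) = dyadic_chain n k.
Proof.
elim: m => [|m IH]; first by rewrite muln1.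
by rewrite addSn expnS mulnCA mul2n /= odd_double doubleK.
Qed.

(** Both fractions are brought to the common denominator [2^(m + n)], where only the indices are
    compared. *)
Lemma dyadic_chain_le m i n j : (i * 2 ^ n <= j * 2 ^ m)%N ->
  dyadic_chain m i `<=` dyadic_chain n j.
Proof.
move=> ij; rewrite -(dyadic_chainD m n i) -(dyadic_chainD n m j) addnC.
exact: dyadic_chain_homo.
Qed.

End dyadic_chain.

Lemma dyadic_between (R : realType) (a b : R) : 0 <= a -> a < b ->
  exists n k : nat, a < k%:R / 2 ^+ n /\ k.+1%:R / 2 ^+ n < b.
Proof.
(* Since [2^n > n > 2 / (b - a)], the scaled interval is longer than 2 and has room for two
   consecutive integers above [a * 2^n]. *)
move=> a0 ab; pose n := (Num.truncn (2 / (b - a))).+1.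
have d0 : 0 < b - a by rewrite subr_gt0.
have p0 : 0 < 2 ^+ n :> R by rewrite exprn_gt0.
have ban : 2 < 2 ^+ n * (b - a).
  rewrite -ltr_pdivrMr//; apply: lt_trans (truncnS_gt _) _.
  by rewrite -natrX ltr_nat ltn_expl.
have an0 : 0 <= a * 2 ^+ n by rewrite mulr_ge0// ltW.
have /andP[k1 k2] := truncn_itv an0.
exists n, (Num.truncn (a * 2 ^+ n)).+1.
rewrite ltr_pdivlMr// ltr_pdivrMr//; split => //.
rewrite -addn2 natrD; rewrite mulrBr ![2 ^+ n * _]mulrC in ban; lra.
Qed.

Lemma prec_urysohn (R : realType) (X : Type) (prec : set X -> set X -> Prop) :
  neighbourhood_operator prec -> N0 prec -> N1 prec -> N2 prec -> N4 prec ->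
  forall A B : set X, prec A (~` B) ->
  exists g : X -> R,
    [/\ forall x, 0 <= g x <= 1, forall x, A x -> g x = 0,
        forall x, B x -> g x = 1 &
        forall a b, a < b -> prec [set x | g x <= a] [set x | g x < b]].
Proof.
move=> pop p0 p1 p2 p4 A B AB.
(* The interpolation must be a total function; unrelated pairs get the junk value [set0]. *)
have /choice[h hP] : forall AC : set X * set X, exists D, prec AC.1 AC.2 ->
    prec AC.1 D /\ prec D AC.2.
  move=> [E C]; have [/p4[D ?]|nEC] := pselect (prec E C); first by exists D.
  by exists set0 => /nEC.
pose V0 k := if k is k'.+1 then if k' is 0 then ~` B else setT else A.
pose V := dyadic_chain (fun E C => h (E, C)) V0.
have hP' E C : prec E C -> prec E (h (E, C)) /\ prec (h (E, C)) C := hP (E, C).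
have V0P k : prec (V0 k) (V0 k.+1) by case: k => [|[|k]] //=; exact: p0.
have VP n k : prec (V n k) (V n k.+1) := dyadic_chain_prec hP' V0P n k.
have Vle m i n j : (i * 2 ^ n <= j * 2 ^ m)%N -> V m i `<=` V n j.
  exact: (dyadic_chain_le pop hP' V0P).
(* The extra point 1 makes [S x] nonempty and caps the infimum at 1. *)
pose S x : set R :=
  [set 1] `|` [set r | exists n k, r = k%:R / 2 ^+ n /\ V n k x].
have S1 x : S x 1 by left.
have S0 x : lbound (S x) 0.
  by move=> r [->//|[n [k [-> _]]]]; rewrite divr_ge0// exprn_ge0.
have lbS x : has_lbound (S x) by exists 0.
pose g x := inf (S x).
have g0 x : 0 <= g x by apply: lb_le_inf => //; exists 1.
exists g; split.
- by move=> x; rewrite g0 ge_inf.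
- move=> x Ax; apply/eqP; rewrite eq_le g0 andbT; apply: ge_inf => //.
  by right; exists 0%N, 0%N; rewrite mul0r.
- move=> x Bx; apply/eqP; rewrite eq_le ge_inf//=; apply: lb_le_inf.
    by exists 1.
  move=> r [->//|[n [k [-> Vx]]]].
  rewrite leNgt ltr_pdivrMr ?exprn_gt0// mul1r -natrX ltr_nat; apply/negP => kn.
  have k1 : (k * 2 ^ 0 <= 1 * 2 ^ n)%N by rewrite muln1 mul1n ltnW.
  exact: (Vle _ _ _ _ k1 x Vx Bx).
- move=> a b ab.
  have [a0|a0] := ltP a 0.
    rewrite [X in prec X _](_ : _ = set0); first exact: prec_set0.
    by apply/seteqP; split => x //= ga; have := g0 x; lra.
  have [b1|b1] := ltP 1 b.
    rewrite [X in prec _ X](_ : _ = setT); first exact: p0.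
    by apply/seteqP; split => x //= _; apply: le_lt_trans b1; exact: ge_inf.
  have [n [k [ak kb]]] := dyadic_between a0 ab.
  apply: (precW p1 p2 _ _ (VP n k)) => x /=.
    move=> ga; have [||r Sr rk] := @inf_lt _ (S x) (k%:R / 2 ^+ n).
    + by exists 1.
    + exact: le_lt_trans ak.
    + case: Sr rk => [->|[m [j [-> Vx]]]].
        (* The extra point 1 cannot lie below [k / 2^n], because [k.+1 / 2^n < b <= 1]. *)
        have : k%:R / 2 ^+ n <= k.+1%:R / 2 ^+ n :> R.
          by rewrite ler_pM2r ?invr_gt0 ?exprn_gt0// ler_nat.
        lra.
      rewrite ltr_pdivrMr ?exprn_gt0// mulrAC ltr_pdivlMr ?exprn_gt0//.
      rewrite -!natrX -!natrM ltr_nat => /ltnW jk.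
      exact: (Vle _ _ _ _ jk x Vx).
  by move=> Vx; apply: le_lt_trans kb; apply: ge_inf => //; right; exists n, k.+1.
Qed.

Lemma prec_preimage_compact (R : realType) (X : Type)
    (prec : set X -> set X -> Prop) (g : X -> R) :
  N0 prec -> N1 prec -> N2 prec -> N3 prec ->
  (forall a b, a < b -> prec [set x | g x <= a] [set x | g x < b]) ->
  forall K W : set R, compact K -> open W -> K `<=` W ->
  prec (g @^-1` K) (g @^-1` W).
Proof.
move=> p0 p1 p2 p3 gP K W cK oW KW.
have gP' a b : a < b -> prec [set x | b <= g x] [set x | a < g x].
  move=> ab; apply: (precW p1 p2 _ _ (p1 _ _ (gP _ _ ab))) => x /=.
    by rewrite leNgt => /negP.
  by move/negP; rewrite -ltNge.
pose D := [set p : R * R | prec (g @^-1` `]p.1, p.2[%classic) (g @^-1` W)].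
move: cK; rewrite compact_cover => /(_ _ D (fun p => `]p.1, p.2[%classic)).
case.
- by move=> p _; exact: itv_open.
- move=> t /KW Wt; have /nbhs_ballP[e /= e0 eW] := open_nbhs_nbhs (conj oW Wt).
  (* Halving the radius leaves a gap on each side, so the preimage of this interval is below that of
     the ball of radius [e], which stays in [W]. *)
  exists (t - e / 2, t + e / 2); last first.
    by rewrite /= in_itv/=; apply/andP; split; lra.
  have /prec_setI := gP' (t - e) (t - e / 2) ltac:(lra).
  move=> /(_ p1 p3 _ _ (gP (t + e / 2) (t + e) ltac:(lra))).
  apply: (precW p1 p2) => x /=.
    by rewrite in_itv/= => /andP[? ?]; split; exact: ltW.
  move=> [? ?]; apply: eW; rewrite /ball/= ltr_norml; apply/andP; split; lra.
- move=> D' D'D KD'; apply: (precW p1 p2 _ (@subset_refl _ _)); last first.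
    apply: (@prec_bigcup_fset _ _ _ D' (fun p => g @^-1` `]p.1, p.2[%classic)) => //.
    by move=> p /D'D /set_mem.
  by move=> x /= /KD' [p pD' xp]; exists p.
Qed.

Lemma continuous_unit_interval (R : realType) (X : Type)
    (prec : set X -> set X -> Prop) (f : X -> unit_interval R) :
  N0 prec -> N1 prec -> N2 prec -> N3 prec ->
  (forall a b, a < b -> prec [set x | set_val (f x) <= a]
                             [set x | set_val (f x) < b]) ->
  neighbourhood_continuous prec (@topological_prec (unit_interval R)) f.
Proof.
move=> p0 p1 p2 p3 fP A B [U [[W oW WU] clAU UB]].
have [O oO OA] : open (~` closure A) by exact/closed_openC/closed_closure.
(* This compact set is the closure of [A] viewed inside the real line, [O] being an open set whose
   trace on [0, 1] is the complement of that closure. *)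
have cK : compact (`[0, 1]%classic `&` ~` O).
  by apply: compact_closedI; [exact: segment_compact|exact: open_closedC].
apply: (precW p1 p2 _ _ (prec_preimage_compact p0 p1 p2 p3 fP cK oW _)).
- move=> x Ax; split; first exact: set_valP.
  move=> Ofx; have : (~` closure A) (f x) by rewrite -OA.
  by apply; exact: subset_closure.
- by move=> x Wfx; apply: UB; rewrite -WU.
- move=> t [t01 Ot].
  pose u : unit_interval R := SigSub (mem_set t01).
  have : U u; last by rewrite -WU.
  apply: clAU; apply: contrapT => nA; apply: Ot.
  by have : (~` closure A) u by []; rewrite -OA.
Qed.

Lemma topological_prec_unit_interval (R : realType) (a b : R) : a < b ->
  topological_prec [set u : unit_interval R | set_val u <= a]
                   [set u | set_val u < b].
Proof.
move=> ab; exists [set u | set_val u < b]; split => //.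
  by exists [set t | t < b] => //; exact: open_lt.
have cv : continuous (set_val : unit_interval R -> R)
  by exact: initial_continuous.
have /closure_id <- : closed [set u : unit_interval R | set_val u <= a].
  by apply: (@closed_comp _ _ set_val [set t | t <= a]) => [u _|];
    [exact: cv|exact: closed_le].
by move=> u /= ua; exact: le_lt_trans ab.
Qed.

Theorem theorem4p9 (R : realType) (X : Type) (prec : set X -> set X -> Prop)
    (prec_op : neighbourhood_operator prec)
    (prec0 : N0 prec) (prec1 : N1 prec) (prec2 : N2 prec) (prec3 : N3 prec) :
  N4 prec <->
  (forall A B : set X, prec A (~` B) ->
    exists f : X -> unit_interval R,
      [/\ neighbourhood_continuous prec (@topological_prec (unit_interval R)) f,
          (fun x => set_val (f x)) @` A `<=` [set (0 : R)] &
          (fun x => set_val (f x)) @` B `<=` [set (1 : R)]]).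
Proof.
split=> [p4 A B AB|sep A C AC].
  have [g [g01 gA gB gP]] := prec_urysohn R prec_op prec0 prec1 prec2 p4 AB.
  have gI x : `[0, 1]%classic (g x) by rewrite /= in_itv/= g01.
  exists (fun x => SigSub (mem_set (gI x)) : unit_interval R); split.
  - exact: continuous_unit_interval.
  - by move=> _ [x Ax <-]; exact: gA.
  - by move=> _ [x Bx <-]; exact: gB.
have [|f [cf fA fC]] := sep A (~` C); first by rewrite setCK.
have fP (a b : R) : a < b ->
    prec [set x | set_val (f x) <= a] [set x | set_val (f x) < b].
  by move=> ab; exact: cf (topological_prec_unit_interval ab).
(* [A] lies in [{f <= 0}], and [{f < 1}] lies in [C] because [f] is 1 off [C]; the threshold 1/2
   sits strictly between. *)
exists [set x | set_val (f x) < 1 / 2]; split.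
- apply: (precW prec1 prec2 _ (@subset_refl _ _) (fP 0 (1 / 2) ltac:(lra))).
  by move=> x Ax /=; rewrite (fA (set_val (f x)))//; exists x.
- apply: (precW prec1 prec2 _ _ (fP (1 / 2) 1 ltac:(lra))) => x /=.
    exact: ltW.
  move=> fx1; apply: contrapT => nC; move: fx1.
  by rewrite (fC (set_val (f x))) ?ltxx//; exists x.
Qed.
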